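(* Let $K$ be a field and let $L$ be a Lie ideal of $\mathscr T_K^-$. If $L\not\subseteq K1$, then $\mathfrak s\subseteq L$.
   Context: Let $K$ be a field. The algebraic Toeplitz algebra $\mathscr T_K$ is the Leavitt path algebra over $K$ of the graph with two vertices $v,w$ and two edges, $e$ from $v$ to $v$ and $f$ from $v$ to $w$. Concretely, it is the associative unital $K$-algebra generated by $v,w,e,f,e^*,f^*$ subject to: $1=v+w$; $v^2=v$, $w^2=w$, $vw=wv=0$; $ve=ev=e$, $vf=fw=f$, $ve^*=e^*v=e^*$, $wf^*=f^*v=f^*$; $e^*e=v$, $f^*f=w$, $e^*f=f^*e=0$; $v=ee^*+ff^*$. $\mathscr T_K^-$ is the Lie algebra on $\mathscr T_K$ with bracket $[a,b]=ab-ba$. A Lie ideal of $\mathscr T_K^-$ is a $K$-subspace $L$ with $[a,x]\in L$ for all $a\in\mathscr T_K$, $x\in L$. $F=I(w)$ is the two-sided ideal of $\mathscr T_K$ generated by $w$, and $\mathfrak s=[F,F]$ is the $K$-span of all $[a,b]$ with $a,b\in F$. *)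

(* Defs.v *)
From HB Require Import structures.
From mathcomp Require Import all_boot all_order all_algebra.
From mathcomp Require Import generic_quotient.
From mathcomp Require Import boolp classical_sets.

Set Implicit Arguments.
Unset Strict Implicit.
Unset Printing Implicit Defensive.

Import GRing.Theory.
Local Open Scope ring_scope.
Local Open Scope classical_set_scope.

(* The algebra on six generators subject to the Toeplitz relations is built as
   the quotient of the formal noncommutative polynomial expressions over K by
   the smallest congruence that contains the axioms of associative unital
   K-algebras and the relations.  Its universal property is stated in
   [toep_lift] and [toep_lift_unique] below. *)

Variant toep_gen := GV | GW | GE | GF | GEs | GFs.

Inductive toep_term (K : Type) : Type :=
| Tgen of toep_gen
| Tzero
| Tone
| Tadd of toep_term K & toep_term K
| Topp of toep_term K
| Tmul of toep_term K & toep_term K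
| Tscale of K & toep_term K.

Arguments Tgen {K}.
Arguments Tzero {K}.
Arguments Tone {K}.

Declare Scope toep_scope.
Delimit Scope toep_scope with toep.
Bind Scope toep_scope with toep_term.
Notation "0" := Tzero : toep_scope.
Notation "1" := Tone : toep_scope.
Notation "s + t" := (Tadd s t) : toep_scope.
Notation "- s" := (Topp s) : toep_scope.
Notation "s * t" := (Tmul s t) : toep_scope.
Notation "a *: s" := (Tscale a s) : toep_scope.

Section Relations.
Local Notation v := (Tgen GV).
Local Notation w := (Tgen GW).
Local Notation e := (Tgen GE).
Local Notation f := (Tgen GF).
Local Notation e' := (Tgen GEs).
Local Notation f' := (Tgen GFs).

Variant toep_rel (K : Type) : toep_term K -> toep_term K -> Prop :=
| TR_1  : toep_rel 1 (v + w)
| TR_vv : toep_rel (v * v) v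
| TR_ww : toep_rel (w * w) w
| TR_vw : toep_rel (v * w) 0
| TR_wv : toep_rel (w * v) 0
| TR_ve : toep_rel (v * e) e
| TR_ev : toep_rel (e * v) e
| TR_vf : toep_rel (v * f) f
| TR_fw : toep_rel (f * w) f
| TR_ve' : toep_rel (v * e') e'
| TR_e'v : toep_rel (e' * v) e'
| TR_wf' : toep_rel (w * f') f'
| TR_f'v : toep_rel (f' * v) f'
| TR_e'e : toep_rel (e' * e) v
| TR_f'f : toep_rel (f' * f) w
| TR_e'f : toep_rel (e' * f) 0
| TR_f'e : toep_rel (f' * e) 0
| TR_v  : toep_rel v (e * e' + f * f').

End Relations.

Inductive toep_cong (K : fieldType) : toep_term K -> toep_term K -> Prop :=
| TC_rel s t : toep_rel s t -> toep_cong s t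
| TC_refl s : toep_cong s s
| TC_sym s t : toep_cong s t -> toep_cong t s
| TC_trans s t u : toep_cong s t -> toep_cong t u -> toep_cong s u
| TC_add s s' t t' :
    toep_cong s s' -> toep_cong t t' -> toep_cong (s + t) (s' + t')
| TC_opp s s' : toep_cong s s' -> toep_cong (- s) (- s')
| TC_mul s s' t t' :
    toep_cong s s' -> toep_cong t t' -> toep_cong (s * t) (s' * t')
| TC_scale a s s' : toep_cong s s' -> toep_cong (a *: s) (a *: s')
| TC_addA s t u : toep_cong (s + (t + u)) (s + t + u)
| TC_addC s t : toep_cong (s + t) (t + s)
| TC_add0 s : toep_cong (0 + s) s
| TC_addN s : toep_cong (- s + s) 0
| TC_mulA s t u : toep_cong (s * (t * u)) (s * t * u)
| TC_mul1l s : toep_cong (1 * s) s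
| TC_mul1r s : toep_cong (s * 1) s
| TC_mulDl s t u : toep_cong ((s + t) * u) (s * u + t * u)
| TC_mulDr s t u : toep_cong (s * (t + u)) (s * t + s * u)
| TC_scaleA a b s : toep_cong (a *: (b *: s)) ((a * b)%R *: s)
| TC_scale1 s : toep_cong (1%R *: s) s
| TC_scaleDr a s t : toep_cong (a *: (s + t)) (a *: s + a *: t)
| TC_scaleDl a b s : toep_cong ((a + b)%R *: s) (a *: s + b *: s)
| TC_scaleAl a s t : toep_cong (a *: (s * t)) ((a *: s) * t)
| TC_scaleAr a s t : toep_cong (a *: (s * t)) (s * (a *: t)).

HB.instance Definition _ (K : Type) := gen_eqMixin (toep_term K).
HB.instance Definition _ (K : Type) := gen_choiceMixin (toep_term K).

Section Eval.
Variables (K : fieldType) (A : algType K) (g : toep_gen -> A).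

Fixpoint toep_eval (t : toep_term K) : A :=
  match t with
  | Tgen i => g i
  | Tzero => 0
  | Tone => 1
  | Tadd s u => toep_eval s + toep_eval u
  | Topp s => - toep_eval s
  | Tmul s u => toep_eval s * toep_eval u
  | Tscale a s => a *: toep_eval s
  end.

Definition toep_family := forall s t, toep_rel s t -> toep_eval s = toep_eval t.

Lemma toep_eval_cong s t :
  toep_family -> toep_cong s t -> toep_eval s = toep_eval t.
Proof.
move=> hg; elim=> //=.
- by move=> ? ? ? _ -> _ ->.
- by move=> ? ? ? ? _ -> _ ->.
- by move=> ? ? _ ->.
- by move=> ? ? ? ? _ -> _ ->.
- by move=> ? ? ? _ ->.
- by move=> *; rewrite addrA.
- by move=> *; rewrite addrC.
- by move=> *; rewrite add0r.
- by move=> *; rewrite addNr.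
- by move=> *; rewrite mulrA.
- by move=> *; rewrite mul1r.
- by move=> *; rewrite mulr1.
- by move=> *; rewrite mulrDl.
- by move=> *; rewrite mulrDr.
- by move=> *; rewrite scalerA.
- by move=> *; rewrite scale1r.
- by move=> *; rewrite scalerDr.
- by move=> *; rewrite scalerDl.
- by move=> *; rewrite scalerAl.
- by move=> *; rewrite scalerAr.
Qed.

End Eval.

Section Quotient.
Variable K : fieldType.

Definition toep_congb (s t : toep_term K) : bool := `[< toep_cong s t >].

Lemma toep_congb_refl : reflexive toep_congb.
Proof. by move=> s; apply/asboolP; exact: TC_refl. Qed.

Lemma toep_congb_sym : symmetric toep_congb.
Proof. by move=> s t; apply/asboolP/asboolP => h; exact: TC_sym. Qed.

Lemma toep_congb_trans : transitive toep_congb.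
Proof.
move=> t s u /asboolP st /asboolP tu; apply/asboolP; exact: TC_trans tu.
Qed.

Canonical toep_congb_equiv :=
  EquivRel toep_congb toep_congb_refl toep_congb_sym toep_congb_trans.

Definition toeplitz := {eq_quot toep_congb}%qT.
HB.instance Definition _ := Choice.on toeplitz.
HB.instance Definition _ := EqQuotient.on toeplitz.

Definition toep_class (t : toep_term K) : toeplitz := (\pi_toeplitz t)%qT.
Definition toep_repr (x : toeplitz) : toep_term K := repr x.

Lemma toep_classP s t : toep_class s = toep_class t <-> toep_cong s t.
Proof.
by split=> [/eqmodP/asboolP | h]; last by apply/eqmodP/asboolP.
Qed.

Lemma toep_reprK x : toep_class (toep_repr x) = x.
Proof. exact: reprK. Qed.

Lemma toep_repr_cong t : toep_cong (toep_repr (toep_class t)) t.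
Proof. by apply/toep_classP; rewrite toep_reprK. Qed.

Lemma toep_ind (P : toeplitz -> Prop) :
  (forall t, P (toep_class t)) -> forall x, P x.
Proof. by move=> h x; rewrite -(toep_reprK x). Qed.

Definition toep_add (x y : toeplitz) :=
  toep_class (toep_repr x + toep_repr y)%toep.
Definition toep_opp (x : toeplitz) := toep_class (- toep_repr x)%toep.
Definition toep_mul (x y : toeplitz) :=
  toep_class (toep_repr x * toep_repr y)%toep.
Definition toep_scale (a : K) (x : toeplitz) :=
  toep_class (a *: toep_repr x)%toep.

Lemma toep_addE s t :
  toep_add (toep_class s) (toep_class t) = toep_class (s + t)%toep.
Proof. by apply/toep_classP; apply: TC_add; exact: toep_repr_cong. Qed.
Lemma toep_oppE s : toep_opp (toep_class s) = toep_class (- s)%toep.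
Proof. by apply/toep_classP; apply: TC_opp; exact: toep_repr_cong. Qed.
Lemma toep_mulE s t :
  toep_mul (toep_class s) (toep_class t) = toep_class (s * t)%toep.
Proof. by apply/toep_classP; apply: TC_mul; exact: toep_repr_cong. Qed.
Lemma toep_scaleE a s :
  toep_scale a (toep_class s) = toep_class (a *: s)%toep.
Proof. by apply/toep_classP; apply: TC_scale; exact: toep_repr_cong. Qed.

Let opE := (toep_addE, toep_oppE, toep_mulE, toep_scaleE).

Fact toep_addA : associative toep_add.
Proof.
elim/toep_ind=> s; elim/toep_ind=> t; elim/toep_ind=> u.
by rewrite !opE; apply/toep_classP; constructor.
Qed.
Fact toep_addC : commutative toep_add.
Proof.
elim/toep_ind=> s; elim/toep_ind=> t.
by rewrite !opE; apply/toep_classP; exact: TC_addC.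
Qed.
Fact toep_add0 : left_id (toep_class 0%toep) toep_add.
Proof. by elim/toep_ind=> s; rewrite !opE; apply/toep_classP; exact: TC_add0. Qed.
Fact toep_addN : left_inverse (toep_class 0%toep) toep_opp toep_add.
Proof. by elim/toep_ind=> s; rewrite !opE; apply/toep_classP; exact: TC_addN. Qed.

HB.instance Definition _ :=
  GRing.isZmodule.Build toeplitz toep_addA toep_addC toep_add0 toep_addN.

Fact toep_mulA : associative toep_mul.
Proof.
elim/toep_ind=> s; elim/toep_ind=> t; elim/toep_ind=> u.
by rewrite !opE; apply/toep_classP; exact: TC_mulA.
Qed.
Fact toep_mul1l : left_id (toep_class 1%toep) toep_mul.
Proof. by elim/toep_ind=> s; rewrite !opE; apply/toep_classP; exact: TC_mul1l. Qed.
Fact toep_mul1r : right_id (toep_class 1%toep) toep_mul.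
Proof. by elim/toep_ind=> s; rewrite !opE; apply/toep_classP; exact: TC_mul1r. Qed.
Fact toep_mulDl : left_distributive toep_mul toep_add.
Proof.
elim/toep_ind=> s; elim/toep_ind=> t; elim/toep_ind=> u.
by rewrite !opE; apply/toep_classP; exact: TC_mulDl.
Qed.
Fact toep_mulDr : right_distributive toep_mul toep_add.
Proof.
elim/toep_ind=> s; elim/toep_ind=> t; elim/toep_ind=> u.
by rewrite !opE; apply/toep_classP; exact: TC_mulDr.
Qed.

(* Nontriviality, through the character e, e*, v |-> 1 and f, f*, w |-> 0. *)
Fact toep_1_neq0 : toep_class 1%toep != toep_class 0%toep.
Proof.
apply/eqP => /toep_classP h.
pose g i : K^o := if i is (GV | GE | GEs) then 1 else 0.
have hg : toep_family g.
  by move=> s t; case=> /=; rewrite ?(mulr1, mulr0, addr0).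
by have /eqP := toep_eval_cong hg h; rewrite /= oner_eq0.
Qed.

HB.instance Definition _ := GRing.Zmodule_isNzRing.Build toeplitz
  toep_mulA toep_mul1l toep_mul1r toep_mulDl toep_mulDr toep_1_neq0.

Fact toep_scaleA a b x : toep_scale a (toep_scale b x) = toep_scale (a * b) x.
Proof.
elim/toep_ind: x => s.
by rewrite !opE; apply/toep_classP; exact: TC_scaleA.
Qed.
Fact toep_scale1 : left_id 1 toep_scale.
Proof. by elim/toep_ind=> s; rewrite !opE; apply/toep_classP; exact: TC_scale1. Qed.
Fact toep_scaleDr : right_distributive toep_scale +%R.
Proof.
move=> a; elim/toep_ind=> s; elim/toep_ind=> t.
change (toep_scale a (toep_add (toep_class s) (toep_class t)) =
  toep_add (toep_scale a (toep_class s)) (toep_scale a (toep_class t))).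
by rewrite !opE; apply/toep_classP; exact: TC_scaleDr.
Qed.
Fact toep_scaleDl x : {morph toep_scale^~ x : a b / a + b}.
Proof.
elim/toep_ind: x => s a b.
by rewrite !toep_scaleE [RHS]toep_addE; apply/toep_classP; exact: TC_scaleDl.
Qed.

HB.instance Definition _ := GRing.Zmodule_isLmodule.Build K toeplitz
  toep_scaleA toep_scale1 toep_scaleDr toep_scaleDl.

Fact toep_scaleAl (a : K) (x y : toeplitz) : a *: (x * y) = a *: x * y.
Proof.
elim/toep_ind: x => s; elim/toep_ind: y => t.
change (toep_scale a (toep_mul (toep_class s) (toep_class t)) =
  toep_mul (toep_scale a (toep_class s)) (toep_class t)).
by rewrite !opE; apply/toep_classP; exact: TC_scaleAl.
Qed.

HB.instance Definition _ :=
  GRing.Lmodule_isLalgebra.Build K toeplitz toep_scaleAl.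

Fact toep_scaleAr (a : K) (x y : toeplitz) : a *: (x * y) = x * (a *: y).
Proof.
elim/toep_ind: x => s; elim/toep_ind: y => t.
change (toep_scale a (toep_mul (toep_class s) (toep_class t)) =
  toep_mul (toep_class s) (toep_scale a (toep_class t))).
by rewrite !opE; apply/toep_classP; exact: TC_scaleAr.
Qed.

HB.instance Definition _ :=
  GRing.Lalgebra_isAlgebra.Build K toeplitz toep_scaleAr.

Definition toep_elt (i : toep_gen) : toeplitz := toep_class (Tgen i).

Lemma toep_eval_elt t : toep_eval toep_elt t = toep_class t.
Proof.
elim: t => //= [s -> t ->|s ->|s -> t ->|a s ->].
- exact: toep_addE.
- exact: toep_oppE.
- exact: toep_mulE.
- exact: toep_scaleE.
Qed.

Lemma toep_elt_family : toep_family toep_elt.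
Proof.
by move=> s t st; rewrite !toep_eval_elt; apply/toep_classP; exact: TC_rel.
Qed.

End Quotient.

Section Universal.
Variables (K : fieldType) (A : algType K).

Lemma toep_lift (g : toep_gen -> A) : toep_family g ->
  exists phi : {lrmorphism toeplitz K -> A}, forall i, phi (toep_elt K i) = g i.
Proof.
move=> hg; pose phi (x : toeplitz K) := toep_eval g (toep_repr x).
have phiE t : phi (toep_class t) = toep_eval g t.
  exact: toep_eval_cong hg (toep_repr_cong t).
have lin : linear phi.
  move=> a; elim/toep_ind=> s; elim/toep_ind=> t.
  rewrite [X in phi (X + _)](toep_scaleE a s) [X in phi X]toep_addE.
  by rewrite !phiE.
have mon : monoid_morphism phi.
  split; first exact: phiE.
  elim/toep_ind=> s; elim/toep_ind=> t.
  by rewrite [X in phi X]toep_mulE !phiE.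
pose l := GRing.isLinear.Build K (toeplitz K) A *:%R phi lin.
pose m := GRing.isMonoidMorphism.Build (toeplitz K) A phi mon.
pose F : {lrmorphism toeplitz K -> A} := HB.pack phi l m.
by exists F => i; exact: phiE.
Qed.

Lemma toep_lift_unique (phi psi : {lrmorphism toeplitz K -> A}) :
  (forall i, phi (toep_elt K i) = psi (toep_elt K i)) -> phi =1 psi.
Proof.
move=> h; elim/toep_ind => t; rewrite -toep_eval_elt.
elim: t => //= [||s IHs t IHt|s IHs|s IHs t IHt|a s IHs].
- by rewrite !rmorph0.
- by rewrite !rmorph1.
- by rewrite !rmorphD; congr (_ + _).
- by rewrite !rmorphN; congr (- _).
- by rewrite !rmorphM; congr (_ * _).
- by rewrite !linearZ; congr (_ *: _).
Qed.

End Universal.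

Definition lie_bracket (A : pzRingType) (a b : A) : A := a * b - b * a.

Section LieIdeals.
Variables (K : fieldType) (A : algType K).

Definition subspace (L : set A) : Prop := submod_closed [in L].

Definition lie_ideal (L : set A) : Prop :=
  subspace L /\ forall a x, L x -> L (lie_bracket a x).

Definition two_sided_ideal (I : set A) : Prop :=
  zmod_closed [in I] /\ forall a x, I x -> I (a * x) /\ I (x * a).

Definition ideal_gen (X : set A) : set A := smallest two_sided_ideal X.

Definition lin_span (X : set A) : set A := smallest subspace X.

Definition commutator_span (X Y : set A) : set A :=
  lin_span [set lie_bracket a b | a in X & b in Y].

Definition scalars : set A := [set c%:A | c in [set: K]].

End LieIdeals.
Arguments scalars {K} A.

Definition toep_F (K : fieldType) : set (toeplitz K) :=
  ideal_gen [set toep_elt K GW].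
Arguments toep_F : clear implicits.

Definition toep_s (K : fieldType) : set (toeplitz K) :=
  commutator_span (toep_F K) (toep_F K).
Arguments toep_s : clear implicits.

(* Main.v *)
Require Import Defs.
From mathcomp Require Import all_boot all_order all_algebra.
From mathcomp Require Import boolp classical_sets.

Import GRing.Theory.

(** The elements s = e + f and t = e* + f* generate the Toeplitz algebra and
    satisfy t s = 1, while 1 - s t = w.  So the algebra is the algebra of
    one-sided inverses of Jacobson: every element is a finite sum of terms
    p(s) t^j with p a polynomial ([toeplitz_poly_form]), and the elements
    E_ij = s^i w t^j multiply like matrix units ([matrix_unitM]) and span the
    ideal F generated by w.  In this picture F is the algebra of infinite
    matrices with finitely many nonzero entries, and [F, F] consists of its
    matrices of trace zero.

    Assume w <> 0; otherwise F = 0 and there is nothing to prove.  Then the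
    algebra acts faithfully on the left ideal spanned by the vectors s^i w
    ([faithful_on_defect]), since the coefficients of p can be read off from
    w t^i p(s) w = p_i w.  Hence an element that commutes with every s^i w is
    scalar ([central_on_defect_scalar]).  If L contains a nonscalar x, then some
    y = [s^k w, x] is a nonzero element of L, and its columns vanish from some
    index N on.  If a = y_ij is a nonzero entry of y, then
    [[E_Ni, y], E_j(N+1)] = [E_Ni y, E_j(N+1)] = a E_N(N+1).  So L contains an
    off-diagonal matrix unit ([off_diagonal_unit_in_lie_ideal]), and brackets
    with other matrix units give all of them
    ([off_diagonal_units_in_lie_ideal]) and all the differences E_ii - E_jj.
    It follows that F is contained in L + K w ([ideal_mod_lie_ideal]); as
    [w, w] = 0, the brackets of elements of F lie in L. *)

(** * Algebras generated by a one-sided inverse pair *)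

Section JacobsonAlgebra.
Local Open Scope ring_scope.
Variables (K : fieldType) (A : algType K) (s t : A).
Hypothesis ts1 : t * s = 1.

(** The normal form p_0(s) + p_1(s) t + ... + p_n(s) t^n, written as a Horner
    scheme in t with coefficients on the left: proofs about a general element
    become inductions that peel off p_0, using t w = 0. *)
Inductive poly_form : A -> Prop :=
| poly_form0 : poly_form 0
| poly_formD p x : poly_form x -> poly_form (horner_alg s p + x * t).

Lemma poly_form_add x y : poly_form x -> poly_form y -> poly_form (x + y).
Proof.
move=> fx; elim: fx y => [y|p {}x fx IH _ [|q y fy]]; first by rewrite add0r.
  by rewrite addr0; apply: poly_formD.
rewrite addrACA -rmorphD -mulrDl; apply: poly_formD; exact: IH.
Qed.

Lemma poly_form_scale c x : poly_form x -> poly_form (c *: x).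
Proof.
elim=> [|p {}x _ IH]; first by rewrite scaler0; exact: poly_form0.
have -> : c *: (horner_alg s p + x * t) = horner_alg s (c *: p) + c *: x * t.
  by rewrite scalerDr linearZ /= mulr_algl scalerAl.
exact: poly_formD.
Qed.

Lemma poly_form_horner p : poly_form (horner_alg s p).
Proof. by have := poly_formD p _ poly_form0; rewrite mul0r addr0. Qed.

Lemma poly_form_mult x : poly_form x -> poly_form (x * t).
Proof. by move=> /(poly_formD 0); rewrite rmorph0 add0r. Qed.

Lemma poly_form_muls x : poly_form x -> poly_form (x * s).
Proof.
case=> [|p y fy]; first by rewrite mul0r; exact: poly_form0.
have -> : (horner_alg s p + y * t) * s = horner_alg s (p * 'X) + y.
  by rewrite mulrDl -mulrA ts1 mulr1 rmorphM /= horner_algX.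
by apply: poly_form_add => //; exact: poly_form_horner.
Qed.

(** * Matrix units *)

Definition defect := 1 - s * t.
Local Notation w := defect.
Definition matrix_unit i j := s ^+ i * w * t ^+ j.
Local Notation E := matrix_unit.

Lemma defect_s : w * s = 0.
Proof. by rewrite mulrBl mul1r -mulrA ts1 mulr1 subrr. Qed.

Lemma t_defect : t * w = 0.
Proof. by rewrite mulrBr mulr1 mulrA ts1 mul1r subrr. Qed.

Lemma tX_sX n : t ^+ n * s ^+ n = 1.
Proof.
elim: n => [|n IH]; first by rewrite mulr1.
by rewrite exprSr exprS -mulrA (mulrA t) ts1 mul1r.
Qed.

Lemma defect_tX_sX i n : (i < n)%N -> w * t ^+ i * s ^+ n = 0.
Proof.
move=> ltin; rewrite -(subnKC ltin) addSnnS exprD exprS !mulrA.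
by rewrite -(mulrA w (t ^+ i)) tX_sX mulr1 defect_s mul0r.
Qed.

Lemma tX_sX_defect i n : (i < n)%N -> t ^+ n * (s ^+ i * w) = 0.
Proof.
move=> ltin; rewrite -(subnKC ltin) addSnnS addnC exprD exprSr -!mulrA.
by rewrite (mulrA (t ^+ i)) tX_sX mul1r t_defect mulr0.
Qed.

Lemma defect_tX_sX_defect i j :
  w * t ^+ i * (s ^+ j * w) = (i == j)%:R *: w.
Proof.
have [ij|ji|->] := ltngtP i j.
- by rewrite mulrA defect_tX_sX // mul0r scale0r.
- by rewrite -mulrA tX_sX_defect // mulr0 scale0r.
rewrite -!mulrA (mulrA (t ^+ j)) tX_sX mul1r scale1r.
by rewrite {2}/w mulrBr mulr1 mulrA defect_s mul0r subr0.
Qed.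

Lemma matrix_unitM i j k l : E i j * E k l = (j == k)%:R *: E i l.
Proof.
rewrite /E -!mulrA [w * (t ^+ j * _)]mulrA [s ^+ k * (w * _)]mulrA.
by rewrite [w * t ^+ j * _]mulrA defect_tX_sX_defect -!scalerAl -scalerAr.
Qed.

Lemma horner_alg_sum (a : A) p :
  horner_alg a p = \sum_(i < size p) p`_i *: a ^+ i.
Proof.
rewrite -{1}[p]coefK poly_def linear_sum; apply: eq_bigr => i _ /=.
by rewrite linearZ /= mulr_algl rmorphXn /= horner_algX.
Qed.

(** The coordinate functionals of the left ideal spanned by the s^i w. *)
Lemma defect_tX_horner_defect i p :
  w * t ^+ i * (horner_alg s p * w) = p`_i *: w.
Proof.
rewrite horner_alg_sum mulr_suml mulr_sumr.
under eq_bigr => k _ do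
  rewrite -scalerAl -scalerAr defect_tX_sX_defect scalerA.
rewrite -scaler_suml; congr (_ *: _).
have [ip|pi] := ltnP i (size p).
  rewrite (bigD1 (Ordinal ip)) //= eqxx mulr1 big1 ?addr0 // => k.
  by rewrite -val_eqE /= eq_sym => /negbTE ->; rewrite mulr0.
rewrite nth_default // big1 // => k _.
by rewrite gtn_eqF ?mulr0 // (leq_trans (ltn_ord k)).
Qed.

Lemma defect_horner p : w * horner_alg s p = p`_0 *: w.
Proof.
elim/poly_ind: p => [|p c _]; first by rewrite rmorph0 mulr0 coef0 scale0r.
rewrite coefD coefMX coefC !eqxx add0r rmorphD [p * _]mulrC rmorphM /=.
rewrite horner_algX horner_algC mulrDr mulrA defect_s mul0r add0r.
by rewrite -scalerAr mulr1.
Qed.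

(** * The faithful representation on the left ideal of the defect *)

Hypothesis poly_form_all : forall x, poly_form x.

Lemma mul_defect x : exists p, x * w = horner_alg s p * w.
Proof.
case: (poly_form_all x) => [|p y _]; first by exists 0; rewrite rmorph0.
by exists p; rewrite mulrDl -mulrA t_defect mulr0 addr0.
Qed.

Lemma defect_mul x : exists p, w * x = w * horner_alg t p.
Proof.
elim: (poly_form_all x) => [|p y _ [q wyE]]; first by exists 0; rewrite rmorph0.
exists (q * 'X + (p`_0)%:P).
rewrite rmorphD rmorphM /= horner_algX horner_algC !mulrDr !mulrA wyE.
by rewrite defect_horner -scalerAr mulr1 addrC.
Qed.

(** If x = p(s) + y t, then x w = p(s) w, so x w = 0 forces p = 0; then
    x s^(j+1) w = y s^j w, and the argument repeats with y. *)
Lemma faithful_on_defect x :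
  w != 0 -> (forall j, x * s ^+ j * w = 0) -> x = 0.
Proof.
move=> w0; elim: (poly_form_all x) => // p y _ IH xE.
have p0 : p = 0.
  apply/polyP => i; rewrite coef0.
  have := defect_tX_horner_defect i p.
  have := xE 0; rewrite mulr1 mulrDl -mulrA t_defect mulr0 addr0 => ->.
  by move/eqP; rewrite mulr0 eq_sym scaler_eq0 (negbTE w0) orbF => /eqP.
rewrite p0 rmorph0 add0r in xE *.
rewrite IH ?mul0r // => j; have := xE j.+1.
by rewrite exprS -[y * t * _]mulrA [t * _]mulrA ts1 mul1r.
Qed.

(** Commuting with w gives w x = x w = w x w = c w for a scalar c.  Then
    x s^i w = s^i w x = c s^i w for all i, and x = c by faithfulness. *)
Lemma central_on_defect_scalar x : w != 0 ->
  (forall i, lie_bracket (s ^+ i * w) x = 0) -> scalars A x.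
Proof.
move=> w0 xC.
have {}xC i : s ^+ i * w * x = x * (s ^+ i * w).
  by apply/eqP; rewrite -subr_eq0; apply/eqP/xC.
have [p xw] := mul_defect x.
exists p`_0 => //; apply/esym/subr0_eq/faithful_on_defect => // j.
have wx : w * x = p`_0 *: w.
  have := xC 0; rewrite !mul1r => wx; rewrite wx.
  have := defect_tX_horner_defect 0 p; rewrite -xw mulr1 -wx mulrA => <-.
  have := defect_tX_sX_defect 0 0; rewrite mulr1 mul1r scale1r => ->.
  by rewrite wx.
rewrite !mulrBl -!mulrA -xC -mulrA wx -scalerAr -scalerAl mul1r.
by rewrite subrr.
Qed.

(** The row index i is the degree of the column p(s) w = x s^j w, so that the
    entry is the leading coefficient of p. *)
Lemma nonzero_entry x : w != 0 -> x != 0 ->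
  exists i j a, a != 0 /\ w * t ^+ i * x * s ^+ j * w = a *: w.
Proof.
move=> w0 x0.
have [j xj] : exists j, x * s ^+ j * w <> 0.
  by apply/existsNP => /faithful_on_defect xE; case/eqP: x0; apply: xE.
have [p xp] := mul_defect (x * s ^+ j).
exists (size p).-1, j, (lead_coef p); split; last first.
  by rewrite -!mulrA (mulrA x) xp !mulrA -mulrA defect_tX_horner_defect.
rewrite lead_coef_eq0; apply: contra_notN xj => /eqP p0.
by rewrite xp p0 rmorph0 mul0r.
Qed.

Lemma defect_mul_sX x :
  exists N, forall n, (N <= n)%N -> w * x * s ^+ n = 0.
Proof.
have [p ->] := defect_mul x; exists (size p) => n pn.
rewrite horner_alg_sum mulr_sumr mulr_suml big1 // => i _.
rewrite -scalerAr -scalerAl defect_tX_sX ?scaler0 //.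
exact: leq_trans (ltn_ord i) pn.
Qed.

(** * Lie ideals *)

Section LieIdeal.
Variable L : set A.
Hypothesis lieL : lie_ideal L.

Let L0 : L 0.
Proof. by case: lieL => [[/set_mem]]. Qed.

Let LP a x y : L x -> L y -> L (a *: x + y).
Proof.
by case: lieL => [[_ lin] _] Lx Ly; apply/set_mem/lin; exact/mem_set.
Qed.

Let LZ a x : L x -> L (a *: x).
Proof. by move=> Lx; rewrite -[_ *: _]addr0; apply: LP. Qed.

Let LB a x : L x -> L (a * x - x * a).
Proof. by case: lieL => _; apply. Qed.

(** The condition y s^N = 0 says that the columns of y vanish from index N on,
    and it then holds for all larger exponents; it holds for s^i w x because
    w x is a polynomial in t with w on the left, and for x s^i w because
    w s = 0. *)
Lemma finite_bracket_in_lie_ideal :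
  w != 0 -> ~ (L `<=` scalars A)%classic ->
  exists y N, [/\ L y, y != 0 & y * s ^+ N = 0].
Proof.
move=> w0 /existsNP [x /not_implyP [Lx xS]].
have [i xi] : exists i, lie_bracket (s ^+ i * w) x <> 0.
  by apply/existsNP => /(central_on_defect_scalar _ w0).
have [N NP] := defect_mul_sX x.
exists (lie_bracket (s ^+ i * w) x), N.+1.
split; [exact: LB | exact/eqP | rewrite /lie_bracket].
rewrite mulrBl -[s ^+ i * w * x]mulrA -[s ^+ i * _ * _]mulrA NP ?leqnSn //.
by rewrite mulr0 sub0r exprS -!mulrA (mulrA w) defect_s mul0r !mulr0 oppr0.
Qed.

Lemma off_diagonal_unit_in_lie_ideal :
  w != 0 -> ~ (L `<=` scalars A)%classic ->
  exists i j, i != j /\ L (E i j).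
Proof.
move=> w0 LS.
have [y [N [Ly y0 ys]]] := finite_bracket_in_lie_ideal w0 LS.
have [i [j [a [a0 aE]]]] := nonzero_entry _ w0 y0.
(* Row index N makes y E_Ni vanish in the inner bracket; a column index
   different from N makes E_j(N+1) E_Ni vanish in the outer one. *)
exists N, N.+1; split; first by rewrite ltn_eqF.
have L1 : L (E N i * y).
  by have := LB (E N i) _ Ly; rewrite /E !mulrA ys // !mul0r subr0.
have := LB (E j N.+1) _ L1.
have -> : E j N.+1 * (E N i * y) = 0.
  by rewrite mulrA matrix_unitM gtn_eqF // scale0r mul0r.
have -> : E N i * y * E j N.+1 = a *: E N N.+1.
  transitivity (s ^+ N * (w * t ^+ i * y * s ^+ j * w) * t ^+ N.+1).
    by rewrite /E !mulrA.
  by rewrite aE -scalerAr -scalerAl.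
rewrite sub0r => /(LZ (- a^-1)).
by rewrite scaleNr scalerN opprK scalerA mulVf // scale1r.
Qed.

Lemma matrix_unit_bracket_in i j k l :
  L (E i j) \/ L (E k l) -> L ((j == k)%:R *: E i l - (l == i)%:R *: E k j).
Proof.
rewrite -!matrix_unitM => -[] LE; last exact: LB.
by rewrite -opprB -scaleN1r; apply/LZ/LB.
Qed.

(** From E_ab, change the row index, then the column index.  The intermediate
    units have to stay off the diagonal, so the row b is not reached in this
    way; it is reached through an auxiliary row k. *)
Lemma off_diagonal_units_in_lie_ideal a b : a != b -> L (E a b) ->
  forall i j, i != j -> L (E i j).
Proof.
move=> ab Lab.
have col i j k : j != k -> i != j -> L (E k j) -> L (E i j).
  move=> jk ij Lkj; have := matrix_unit_bracket_in i k k j (or_intror Lkj).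
  by rewrite eqxx scale1r [j == i]eq_sym (negbTE ij) scale0r subr0.
have row i j k : i != j -> L (E i k) -> L (E i j).
  move=> ij Lik; have := matrix_unit_bracket_in i k k j (or_introl Lik).
  by rewrite eqxx scale1r [j == i]eq_sym (negbTE ij) scale0r subr0.
have L1 i j : i != b -> i != j -> L (E i j).
  by move=> ib ij; apply: (row _ _ b) => //; apply: (col _ _ a);
     rewrite // eq_sym.
move=> i j ij; have [ib|ib] := eqVneq i b; last exact: L1.
pose k := (maxn b j).+1.
have [kb kj] : k != b /\ k != j.
  by split; rewrite gtn_eqF // ltnS ?leq_maxl ?leq_maxr.
by apply: (col _ _ k) => //; [rewrite eq_sym | apply: L1].
Qed.

(** Modulo L every E_ij with i <> j vanishes and every E_ii equals E_00 = w, by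
    [E_i0, E_0i] = E_ii - E_00.  The products x w y expand in the E_ij, because
    x w = p(s) w and w y = w q(t). *)
Lemma ideal_mod_lie_ideal : (forall i j, i != j -> L (E i j)) ->
  (ideal_gen [set w] `<=` [set x | exists c, L (x - c *: w)])%classic.
Proof.
move=> LE; set M : set A := (X in (_ `<=` X)%classic).
have M0 : M 0 by exists 0; rewrite scale0r subrr.
have MP a x y : M x -> M y -> M (a *: x + y).
  move=> [c Lc] [d Ld]; exists (a * c + d).
  have -> : a *: x + y - (a * c + d) *: w = a *: (x - c *: w) + (y - d *: w).
    by rewrite scalerDl [a *: (x - _)]scalerBr scalerA opprD addrACA.
  exact: LP.
have ME i j : M (E i j).
  have [->|ij] := eqVneq i j; last first.
    by exists 0; rewrite scale0r subr0; apply: LE.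
  exists 1; have [->|j0] := eqVneq j 0.
    by rewrite /E mulr1 mul1r scale1r subrr.
  have := matrix_unit_bracket_in j 0 0 j (or_introl (LE _ _ j0)).
  by rewrite !eqxx !scale1r {2}/E mulr1 mul1r.
have Msum I (r : seq I) (c : I -> K) (F : I -> A) :
    (forall i, M (F i)) -> M (\sum_(i <- r) c i *: F i).
  by move=> MF; elim/big_rec: _ => // i z _; exact: MP.
have Mw x y : M (x * w * y).
  have [p ->] := mul_defect x; rewrite -mulrA; have [q ->] := defect_mul y.
  rewrite mulrA !horner_alg_sum 2!mulr_suml.
  under eq_bigr => i _ do rewrite -!scalerAl.
  apply: (Msum) => i; rewrite mulr_sumr.
  under eq_bigr => j _ do rewrite -scalerAr.
  by apply: (Msum) => j; exact: ME.
(* The set of z with x z y in M for all x and y is an ideal for any subspace M,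
   whereas M itself is not visibly one. *)
apply: (@subset_trans _ [set z | forall x y, M (x * z * y)]); last first.
  by move=> z /(_ 1 1); rewrite mul1r mulr1.
apply: smallest_sub; last by move=> _ ->.
split; last first.
  move=> a z Mz; split=> x y; first by rewrite (mulrA x); exact: Mz.
  by rewrite (mulrA x) -(mulrA _ a); exact: Mz.
split; first by apply/mem_set => x y; rewrite mulr0 mul0r.
move=> z z' /set_mem Mz /set_mem Mz'; apply/mem_set => x y.
by rewrite mulrBr mulrBl addrC -scaleN1r; apply: MP; [exact: Mz' | exact: Mz].
Qed.

Theorem lie_ideal_contains_commutators :
  ~ (L `<=` scalars A)%classic ->
  (commutator_span (ideal_gen [set w]) (ideal_gen [set w]) `<=` L)%classic.
Proof.
move=> LS; apply: smallest_sub; first by case: lieL.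
move=> _ [x Fx [y Fy <-]].
have [w0|w0] := eqVneq w 0.
  have F0 : (ideal_gen [set w] `<=` [set 0])%classic.
    rewrite w0; apply: smallest_sub => //; split; last first.
      by move=> a _ ->; rewrite mulr0 mul0r.
    split; first exact/mem_set.
    by move=> _ _ /set_mem -> /set_mem ->; apply/mem_set; rewrite /= subrr.
  by rewrite (F0 _ Fx) /lie_bracket mulr0 mul0r subrr; exact: L0.
have [a [b [ab Lab]]] := off_diagonal_unit_in_lie_ideal w0 LS.
have FM := ideal_mod_lie_ideal (off_diagonal_units_in_lie_ideal _ _ ab Lab).
have [[c Lc] [d Ld]] := (FM _ Fx, FM _ Fy).
(* Shifting first y and then x by a multiple of w puts both terms in L. *)
have bracketE u : lie_bracket x y =
    lie_bracket x (y - d *: u) - d *: lie_bracket u (x - c *: u).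
  rewrite /lie_bracket !mulrBr !mulrBl -!scalerAl -!scalerAr.
  rewrite [- (x * u - _)]opprB [u * x - _ + _]addrA subrK scalerBr !opprB.
  by rewrite addrAC !addrA !subrK.
rewrite (bracketE w) addrC -scaleNr; apply: LP; exact: LB.
Qed.
End LieIdeal.
End JacobsonAlgebra.

Arguments defect {K A} s t.
Arguments poly_form {K A} s t _.

(** * The Toeplitz algebra *)

Section Toeplitz.
Local Open Scope ring_scope.
Variable K : fieldType.
Local Notation gen := (toep_elt K).
Local Notation v := (gen GV).
Local Notation w := (gen GW).
Local Notation e := (gen GE).
Local Notation f := (gen GF).
Local Notation e' := (gen GEs).
Local Notation f' := (gen GFs).

Definition shift := e + f.
Definition coshift := e' + f'.
Local Notation S := shift.
Local Notation T := coshift.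

Let relE (a b : toep_term K) (ab : toep_rel a b) :
  toep_eval gen a = toep_eval gen b := toep_elt_family ab.
Let unitE : 1 = v + w := relE _ _ (TR_1 K).
Let vw : v * w = 0 := relE _ _ (TR_vw K).
Let wv : w * v = 0 := relE _ _ (TR_wv K).
Let ev : e * v = e := relE _ _ (TR_ev K).
Let fw : f * w = f := relE _ _ (TR_fw K).
Let ve' : v * e' = e' := relE _ _ (TR_ve' K).
Let wf' : w * f' = f' := relE _ _ (TR_wf' K).
Let e'e : e' * e = v := relE _ _ (TR_e'e K).
Let f'f : f' * f = w := relE _ _ (TR_f'f K).
Let e'f : e' * f = 0 := relE _ _ (TR_e'f K).
Let f'e : f' * e = 0 := relE _ _ (TR_f'e K).
Let vE : v = e * e' + f * f' := relE _ _ (TR_v K).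

Lemma coshift_shift : T * S = 1.
Proof. by rewrite mulrDl !mulrDr e'e e'f f'e f'f addr0 add0r unitE. Qed.

Lemma shift_coshift : S * T = v.
Proof.
rewrite mulrDl !mulrDr vE.
have -> : e * f' = 0 by rewrite -ev -wf' mulrA -(mulrA e) vw mulr0 mul0r.
have -> : f * e' = 0 by rewrite -fw -ve' mulrA -(mulrA f) wv mulr0 mul0r.
by rewrite addr0 add0r.
Qed.

Lemma defect_toeplitz : defect S T = w.
Proof. by rewrite /defect shift_coshift unitE addrC addKr. Qed.

Lemma shift_v : S * v = e.
Proof. by rewrite mulrDl ev -fw -mulrA wv mulr0 addr0. Qed.

Lemma shift_w : S * w = f.
Proof. by rewrite mulrDl fw -ev -mulrA vw mulr0 add0r. Qed.

Lemma v_coshift : v * T = e'.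
Proof. by rewrite mulrDr ve' -wf' mulrA vw mul0r addr0. Qed.

Lemma w_coshift : w * T = f'.
Proof. by rewrite mulrDr wf' -ve' mulrA wv mul0r add0r. Qed.

(** The normal forms contain 1 and are stable under right multiplication by s
    and t, hence by each of the six generators, which are the words
    v = s t, w = 1 - s t, e = s v, f = s w, e* = v t and f* = w t. *)
Lemma toeplitz_poly_form (x : toeplitz K) : poly_form S T x.
Proof.
have add := @poly_form_add _ _ S T.
have scale := @poly_form_scale _ _ S T.
have muls := @poly_form_muls _ _ _ _ coshift_shift.
have mult := @poly_form_mult _ _ S T.
have mulv y : poly_form S T y -> poly_form S T (y * v).
  by move=> fy; rewrite -shift_coshift mulrA; apply/mult/muls.
have mulw y : poly_form S T y -> poly_form S T (y * w).
  move=> fy; rewrite -defect_toeplitz /defect mulrBr mulr1 shift_coshift.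
  by rewrite -scaleN1r; apply/add/scale/mulv.
suff mulx y : poly_form S T y -> poly_form S T (y * x).
  rewrite -[x]mul1r; apply: mulx.
  by rewrite -(rmorph1 (horner_alg S)); exact: poly_form_horner.
elim/toep_ind: x y => a; rewrite -toep_eval_elt.
elim: a => /= [[]||| a IHa b IHb | a IHa | a IHa b IHb | c a IHa] y fy.
- exact: mulv.
- exact: mulw.
- by rewrite -shift_v mulrA; apply/mulv/muls.
- by rewrite -shift_w mulrA; apply/mulw/muls.
- by rewrite -v_coshift mulrA; apply/mult/mulv.
- by rewrite -w_coshift mulrA; apply/mult/mulw.
- by rewrite mulr0; exact: poly_form0.
- by rewrite mulr1.
- by rewrite mulrDr; apply: add; [exact: IHa | exact: IHb].
- by rewrite mulrN -scaleN1r; apply/scale/IHa.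
- by rewrite mulrA; apply/IHb/IHa.
- by rewrite -scalerAr; apply/scale/IHa.
Qed.

End Toeplitz.

Local Open Scope classical_set_scope.

Theorem proposition4p6 (K : fieldType) (L : set (toeplitz K)) :
  lie_ideal L -> ~ (L `<=` scalars (toeplitz K)) -> toep_s K `<=` L.
Proof.
move=> lieL; rewrite /toep_s /toep_F -defect_toeplitz.
exact: lie_ideal_contains_commutators (coshift_shift K)
  (@toeplitz_poly_form K) _ lieL.
Qed.
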